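(* Let $n\ge3$, let $v\in h^\infty(\mathbb{R}^n_+)$ and let $x$ be an arbitrary point in $\mathbb{R}^n_+$. The sharp coefficient $\mathcal{C}_{1,n,\infty}(x)$ in the inequality $$\left|\nabla\big(x_n^{n-1}v(x)\big)\right|\le\mathcal{C}_{1,n,\infty}(x)\,\|v\|_\infty$$ is given by $$\mathcal{C}_{1,n,\infty}(x)=(n-1)\,x_n^{n-2}.$$ The absolute value of the derivative of $x_n^{n-1}v(x)$ with respect to the normal to the boundary of the half-space at any $x\in\mathbb{R}^n_+$ has the same supremum as $|\nabla(x_n^{n-1}v(x))|$.
   Context: $\mathbb{R}^n_+=\{x=(x',x_n):x'\in\mathbb{R}^{n-1},\ x_n>0\}$; $\omega_n=2\pi^{n/2}/\Gamma(n/2)$. $h^\infty(\mathbb{R}^n_+)$ is the space of (real) harmonic functions on $\mathbb{R}^n_+$ representable as the Poisson integral $v(x)=\frac{2}{\omega_n}\int_{\mathbb{R}^{n-1}}\frac{x_n}{|y-x|^n}v(y')\,dy'$, $y=(y',0)$, with boundary values $v(y')$ in $L^\infty(\mathbb{R}^{n-1})$; $\|v\|_\infty$ is the $L^\infty(\mathbb{R}^{n-1})$-norm of the boundary values. ''Sharp coefficient'' at a given $x$ means the smallest one for which the inequality holds for all $v\in h^\infty(\mathbb{R}^n_+)$. The derivative with respect to the normal is $\partial/\partial x_n$; the suprema in the last sentence are over all $v\in h^\infty(\mathbb{R}^n_+)$ with $\|v\|_\infty\le1$. *)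

(* Defs.v *)
(* Points of R^n, n = m.+1, are row vectors in 'rV[R]_m.+1;
   the normal coordinate x_n is x ord0 ord_max. Points y' of the boundary R^m
   are m-tuples, the type that carries the product Borel sigma-algebra. *)
From HB Require Import structures.
From mathcomp Require Export all_boot all_order all_algebra.
From mathcomp Require Export all_classical all_reals all_analysis.
Export numFieldNormedType.Exports.

Set Implicit Arguments.
Unset Strict Implicit.
Unset Printing Implicit Defensive.

Import Order.TTheory GRing.Theory Num.Theory.

Global Open Scope classical_set_scope.
Global Open Scope ring_scope.

Notation bpoint R m := (m.-tuple (measurableTypeR R)).

Section lebesgue_cons.
Context {R : realType} {m : nat}.
Local Open Scope ereal_scope.
Variable mu : {sigma_finite_measure set (bpoint R m) -> \bar R}.

Definition tuple_cons (p : measurableTypeR R * bpoint R m) : bpoint R m.+1 :=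
  [tuple of p.1 :: p.2].

Lemma measurable_tuple_cons : measurable_fun setT tuple_cons.
Proof. exact: measurable_cons. Qed.

Let mtuple_cons A : measurable A -> measurable (tuple_cons @^-1` A).
Proof.
by move=> mA; rewrite -[X in measurable X]setTI; exact: measurable_tuple_cons.
Qed.

Definition lebesgue_cons : set (bpoint R m.+1) -> \bar R :=
  pushforward (lebesgue_measure \x mu) tuple_cons.

Let lebesgue_cons0 : lebesgue_cons set0 = 0.
Proof. by rewrite /lebesgue_cons /pushforward preimage_set0 measure0. Qed.

Let lebesgue_cons_ge0 A : 0 <= lebesgue_cons A.
Proof. by rewrite /lebesgue_cons /pushforward measure_ge0. Qed.

Let lebesgue_cons_sigma_additive : semi_sigma_additive lebesgue_cons.
Proof.
move=> F mF tF mUF; rewrite /lebesgue_cons /pushforward preimage_bigcup.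
apply: measure_semi_sigma_additive.
- by move=> n; exact: mtuple_cons.
- apply/trivIsetP => /= i j _ _ ij; rewrite -preimage_setI.
  by move/trivIsetP : tF => /(_ _ _ _ _ ij) ->//; rewrite preimage_set0.
- by rewrite -preimage_bigcup; exact: mtuple_cons.
Qed.

HB.instance Definition _ := isMeasure.Build _ _ _ lebesgue_cons
  lebesgue_cons0 lebesgue_cons_ge0 lebesgue_cons_sigma_additive.

Let tuple_uncons (t : bpoint R m.+1) : measurableTypeR R * bpoint R m :=
  (thead t, [tuple of behead t] : bpoint R m).

Let tuple_consK : cancel tuple_cons tuple_uncons.
Proof. by move=> [a t]; congr pair; exact: val_inj. Qed.

Let tuple_unconsK : cancel tuple_uncons tuple_cons.
Proof. by move=> t; rewrite [RHS]tuple_eta; exact: val_inj. Qed.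

Let measurable_tuple_uncons : measurable_fun setT tuple_uncons.
Proof.
apply/measurable_fun_pairP; split => /=; first exact: measurable_tnth.
exact: measurable_behead.
Qed.

Let lebesgue_cons_sigma_finite : sigma_finite setT lebesgue_cons.
Proof.
have /sigma_finiteP[G [GT ndG Goo]] := sigma_finiteT (@lebesgue_measure R).
have /sigma_finiteP[H [HT ndH Hoo]] := sigma_finiteT mu.
pose F i := G i `*` H i.
have FT : setT = \bigcup_i F i.
  apply/esym; rewrite -setXTT GT HT predeqE => -[x y]; split.
    by move=> [n _ []/= ? ?]; split; exists n.
  move=> [/= [n _ Gx] [k _ Hy]]; exists (maxn n k) => //; split.
  - by move: x Gx; exact/subsetPset/ndG/leq_maxl.
  - by move: y Hy; exact/subsetPset/ndH/leq_maxr.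
have Foo i : measurable (F i) /\ (lebesgue_measure \x mu) (F i) < +oo.
  have [? ?] := Goo i; have [? ?] := Hoo i; split; first exact: measurableX.
  by rewrite product_measure1E// lte_mul_pinfty// ge0_fin_numE.
exists (fun i => tuple_uncons @^-1` F i).
  by rewrite -preimage_bigcup -FT preimage_setT.
move=> i; have [mFi Fioo] := Foo i; split.
  by rewrite -[X in measurable X]setTI; exact: measurable_tuple_uncons.
rewrite /lebesgue_cons /pushforward -comp_preimage.
rewrite (_ : _ \o _ = id) ?preimage_id//.
by apply/funext => p; exact: tuple_consK.
Qed.

HB.instance Definition _ := Measure_isSigmaFinite.Build _ _ _ lebesgue_cons
  lebesgue_cons_sigma_finite.

End lebesgue_cons.

(* Lebesgue measure on R^m, as an iterated product measure *)
Fixpoint lebesgue_tuple (R : realType) (m : nat) :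
    {sigma_finite_measure set (bpoint R m) -> \bar R} :=
  match m with
  | 0 => [the {sigma_finite_measure set (bpoint R 0) -> \bar R} of
            dirac [tuple] ]
  | m'.+1 => [the {sigma_finite_measure set (bpoint R m'.+1) -> \bar R} of
            lebesgue_cons (lebesgue_tuple R m')]
  end.

Lemma lebesgue_tuple_box (R : realType) (m : nat)
    (A : 'I_m -> set (measurableTypeR R)) :
  (forall i, measurable (A i)) ->
  lebesgue_tuple R m [set y | forall i, A i (tnth y i)] =
  (\prod_(i < m) lebesgue_measure (A i))%E.
Proof.
elim: m A => [|m IH] A mA.
  by rewrite big_ord0 /= diracE (_ : _ \in _)//; apply/mem_set => -[].
rewrite big_ord_recl -IH//= /lebesgue_cons /pushforward.
rewrite (_ : _ @^-1` _ =
    A ord0 `*` [set y | forall i, A (lift ord0 i) (tnth y i)]).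
  rewrite product_measure1E//.
  rewrite (_ : [set y | _] =
      \bigcap_i ((@tnth _ _ ^~ i) @^-1` A (lift ord0 i))).
    apply: fin_bigcap_measurable => // i _; rewrite -[X in measurable X]setTI.
    exact: measurable_tnth.
  by apply/seteqP; split => y /= Ay i; [move=> _|]; exact: Ay.
apply/seteqP; split => [[a y]/= Ay|[a y]/= [Aa Ay] i].
  by split => [|i]; [have := Ay ord0|have := Ay (lift ord0 i); rewrite tnthS].
by case: (unliftP ord0 i) => [j ->|->//]; rewrite tnthS.
Qed.

Section euclidean.
Context {R : realType} {n : nat}.
Implicit Types (f : 'rV[R]_n.+1 -> R) (x : 'rV[R]_n.+1).

(* `|x| on 'rV[R]_n.+1 is the sup norm, hence a separate Euclidean norm. *)
Definition enorm x : R := Num.sqrt (\sum_i x ord0 i ^+ 2).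

Definition partial (i : 'I_n.+1) f x : R := 'D_(delta_mx ord0 i) f x.

Definition grad f x : 'rV[R]_n.+1 := \row_i partial i f x.

Definition laplacian f x : R := \sum_i partial i (partial i f) x.

Definition C2_on (U : set 'rV[R]_n.+1) f := forall x, U x ->
  [/\ differentiable f x,
      forall i, differentiable (partial i f) x &
      forall i j, {for x, continuous (partial j (partial i f))}].

Definition harmonic_on (U : set 'rV[R]_n.+1) f :=
  C2_on U f /\ forall x, U x -> laplacian f x = 0.

End euclidean.

Definition Gamma {R : realType} (s : R) : R :=
  \int[lebesgue_measure]_(t in `]0, +oo[) (t `^ (s - 1) * expR (- t)).

Definition omega {R : realType} (n : nat) : R :=
  2 * pi `^ (n%:R / 2) / Gamma (n%:R / 2).

Section half_space.
Context {R : realType} {m : nat}.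
Implicit Types (v : 'rV[R]_m.+1 -> R) (f : bpoint R m -> R).

Definition normal_coord (x : 'rV[R]_m.+1) : R := x ord0 ord_max.

Definition half_space : set 'rV[R]_m.+1 := [set x | 0 < normal_coord x].

(* (y', 0): the default value of nth fills the last coordinate. *)
Definition bembed (y : bpoint R m) : 'rV[R]_m.+1 :=
  \row_(i < m.+1) nth (0 : R) y i.

Definition poisson f (x : 'rV[R]_m.+1) : R :=
  2 / omega m.+1 * \int[lebesgue_tuple R m]_y
    (normal_coord x / enorm (bembed y - x) ^+ m.+1 * f y).

(* v belongs to h^oo and has boundary values f; f is a Borel representative
   of its class in L^oo, and v is unconstrained outside the half-space. *)
Definition hinfty v f :=
  [/\ harmonic_on half_space v,
      f \in Lfun (lebesgue_tuple R m) +oo%E &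
      forall x, half_space x -> v x = poisson f x].

Definition supnorm f : R :=
  fine ('N[lebesgue_tuple R m]_+oo [EFin \o f])%E.

(* x |-> x_n^{n-1} v(x), with n - 1 = m *)
Definition weighted v : 'rV[R]_m.+1 -> R :=
  fun x => normal_coord x ^+ m * v x.

Definition grad_coefs (x : 'rV[R]_m.+1) : set R := [set C |
  forall v f, hinfty v f -> enorm (grad (weighted v) x) <= C * supnorm f].

(* The smallest admissible coefficient, not merely the infimum. *)
Definition sharp_grad_coef (x : 'rV[R]_m.+1) (C : R) :=
  grad_coefs x C /\ lbound (grad_coefs x) C.

Definition sup_unit_ball (F : ('rV[R]_m.+1 -> R) -> R) : \bar R :=
  ereal_sup [set z | exists v f,
    [/\ hinfty v f, supnorm f <= 1 & z = (F v)%:E]].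

End half_space.

(* Main.v *)
Require Import Defs.
From mathcomp Require Import ring lra measurable_realfun ess_sup_inf.

Set Implicit Arguments.
Unset Strict Implicit.
Unset Printing Implicit Defensive.

Import Order.TTheory GRing.Theory Num.Theory.

(** Write n = m + 1, N = x_n, w = (y, 0) - x and rho = |w|. The weight x_n^(n-1)
    turns the Poisson kernel into (N / rho)^n (lemma [weightedE]), whose
    derivative in the direction z is
      K_z = n N^m rho^-(n+2) A,   A = z_n rho^2 + N <w, z>,
    and differentiation under the integral sign gives
      D_z (x_n^(n-1) v) = (2 / omega_n) int K_z v   (lemma [derive_weighted]).
    So the coefficient is governed by int |K_z| for unit z, and the point is that
    this integral is largest for the normal direction, where K_z >= 0.

    The argument needs neither polar coordinates nor a maximisation over z. By
    the Cauchy-Schwarz inequality for the tangential components,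
      |A| <= z_n A + (1 - z_n^2) / 2 * rho^2   (lemma [slope_bound]),
    so int |K_z| is bounded by a combination of int K_z and int rho^-n. Both are
    read off the constant function v = 1: the normalisation of the Poisson kernel
    gives (2 / omega_n) int rho^-n = 1 / N, and D_z of x_n^(n-1) itself gives
    (2 / omega_n) int K_z = (n-1) N^(n-2) z_n. Altogether
      (2 / omega_n) int |K_z|
        <= N^(n-2) ((n-1) z_n^2 + (n / 2) (1 - z_n^2)) <= (n-1) N^(n-2)
    because n / 2 <= n - 1 (lemma [integral_norm_dkernel]). Taking z along the
    gradient proves the inequality. The function v = 1 has norm 1, and the
    gradient of x_n^(n-1) is normal of length (n-1) x_n^(n-2); hence the
    coefficient is sharp and both suprema equal it.

    That the constant 1 is a Poisson integral at all amounts to the value of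
    omega_n. It follows from Tonelli's theorem: rho^-n is a mixture of Gaussians
    exp (- t rho^2) with a gamma density in t (lemma [gaussian_mixture]), and
    Gaussian integrals factor over the coordinates. *)

(** * The gamma integral and Gaussian mixtures *)

Lemma lebesgue_measure_scale (R : realType) (a : R) (a0 : 0 < a)
    (A : set (measurableTypeR R)) : measurable A ->
  (a^-1%:E * lebesgue_measure A =
   pushforward lebesgue_measure
     (( *%R ^~ a) : measurableTypeR R -> measurableTypeR R) A)%E.
Proof.
move=> mA.
have mf : measurable_fun setT
    (( *%R ^~ a) : measurableTypeR R -> measurableTypeR R).
  exact: measurable_funM.
have -> : lebesgue_measure A =
    pushforward (mscale (NngNum (ltW a0)) (@lebesgue_measure R))
      (( *%R ^~ a) : measurableTypeR R -> measurableTypeR R) A.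
  apply: lebesgue_measure_unique => //= _ [[u v]] _ <-.
  rewrite /mscale/= /pushforward/= (_ : _ @^-1` _ = `]u / a, v / a]%classic); last first.
    by apply/seteqP; split => x /=; rewrite !in_itv/= ltr_pdivrMr// ler_pdivlMr.
  rewrite !lebesgue_measure_itv/= !lte_fin ltr_pM2r ?invr_gt0//.
  case: ifPn => _; last by rewrite mule0.
  by rewrite -!EFinD -EFinM -mulrBl mulrCA divff ?mulr1// gt_eqF.
by rewrite /mscale/= muleA -EFinM mulVf ?mul1e// gt_eqF.
Qed.

Lemma ge0_integral_scale (R : realType) (a : R) (f : R -> \bar R) : 0 < a ->
  measurable_fun [set: measurableTypeR R] f -> (forall x, 0 <= f x)%E ->
  (\int[lebesgue_measure]_(x in `]0%R, +oo[) f (x * a)%R =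
   a^-1%:E * \int[lebesgue_measure]_(x in `]0%R, +oo[) f x)%E.
Proof.
move=> a0 mf f0.
have mM : measurable_fun setT
    (( *%R ^~ a) : measurableTypeR R -> measurableTypeR R).
  exact: measurable_funM.
have av0 : 0 <= a^-1 by rewrite invr_ge0 ltW.
rewrite [in LHS](_ : `]0%R, +oo[%classic = ( *%R ^~ a) @^-1` `]0%R, +oo[); last first.
  by apply/seteqP; split => x /=; rewrite !in_itv/= !andbT pmulr_lgt0.
rewrite -(@ge0_integral_pushforward _ _ _ _ _ _ mM (@lebesgue_measure R)
  `]0, +oo[ f)//; last exact: measurable_funS mf.
rewrite -[a^-1]/((NngNum av0)%:num) -ge0_integral_mscale//; last first.
  exact: measurable_funS mf.
by apply: eq_measure_integral => A mA _; exact/esym/(lebesgue_measure_scale a0).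
Qed.

(** The gamma integral kept in the extended reals: in [gaussian_mixture] a
    product of two such integrals is computed at once, and the finiteness of each
    factor comes out as a consequence. *)
Definition eGamma (R : realType) (s : R) : \bar R :=
  (\int[lebesgue_measure]_(t in `]0%R, +oo[) (t `^ (s - 1) * expR (- t))%:E)%E.

Lemma measurable_gamma_density (R : realType) (s : R) :
  measurable_fun [set: measurableTypeR R] (fun t : R => t `^ (s - 1) * expR (- t)).
Proof.
apply/measurable_funM; first exact: measurable_powR.
by apply: measurableT_comp => //; exact: measurable_funN.
Qed.

Lemma eGamma_scale (R : realType) (s a : R) : 0 < a ->
  (\int[lebesgue_measure]_(t in `]0%R, +oo[) (t `^ (s - 1) * expR (- (t * a)))%:E =
   (a `^ (- s))%:E * eGamma s)%E.
Proof.
move=> a0; pose g (t : R) := (t `^ (s - 1) * expR (- t))%:E.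
have mg : measurable_fun [set: measurableTypeR R] g.
  by apply/measurable_EFinP; exact: measurable_gamma_density.
have g0 x : (0 <= g x)%E by rewrite lee_fin mulr_ge0 ?powR_ge0 ?expR_ge0.
transitivity (\int[lebesgue_measure]_(t in `]0%R, +oo[)
    ((a `^ (1 - s))%:E * g (t * a)%R))%E.
  apply: eq_integral => t; rewrite inE/= in_itv/= andbT => t0.
  rewrite /g -EFinM powRM ?ltW// mulrA [_ `^ (1 - s) * _]mulrCA -powRD; last first.
    by rewrite (gt_eqF a0) implybT.
  by rewrite (_ : 1 - s + (s - 1) = 0) ?powRr0 ?mulr1//; ring.
rewrite ge0_integralZl//=; last 2 first.
- apply: (@measurable_funTS _ _ _ _ _ (g \o ( *%R ^~ a))).
  by apply: measurableT_comp => //; exact: measurable_funM.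
- by rewrite lee_fin powR_ge0.
rewrite ge0_integral_scale// muleA -EFinM; congr (_%:E * _)%E.
rewrite -powR_inv1 ?ltW// -powRD; last by rewrite (gt_eqF a0) implybT.
by congr (_ `^ _); ring.
Qed.

(** Since t^(s-1) exp (- t b) integrates to b^(-s) Gamma(s), the power
    (q + a^2)^(-s) is an average over t of exp (- t q) exp (- t a^2). For
    s = (k + 1) / 2 exchanging the integrals leaves the power t^(-1/2), because
    the Gaussian integral over a k-dimensional space contributes t^(-k/2); hence
    Gamma(1/2) on the right, whatever k is. The hypothesis on [q] is that it
    behaves like a squared distance in dimension [k]. *)
Lemma gaussian_mixture d (T : measurableType d) (R : realType)
    (mu : {sigma_finite_measure set T -> \bar R}) (q : T -> R) (k : nat) (a : R) :
  0 < a -> measurable_fun setT q -> (forall y, 0 <= q y) ->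
  (forall t : R, 0 < t ->
    (\int[mu]_y (expR (- (t * q y))%R)%:E = ((pi / t) `^ (k%:R / 2))%:E)%E) ->
  (eGamma (k.+1%:R / 2)%R *
     \int[mu]_y ((q y + a ^+ 2) `^ (- (k.+1%:R / 2)))%:E =
   (pi `^ (k%:R / 2) / a)%:E * eGamma (1 / 2))%E.
Proof.
move=> a0 mq q0 gq; set s := k.+1%:R / 2.
pose D : set (measurableTypeR R) := `]0, +oo[%classic.
have mD : measurable D by exact: measurable_itv.
pose h (t : R) (y : T) := t `^ (s - 1) * expR (- (t * (q y + a ^+ 2))).
have h0 t y : 0 <= h t y by rewrite mulr_ge0 ?powR_ge0 ?expR_ge0.
pose F (p : measurableTypeR R * T) := ((h p.1 p.2)%:E * (\1_D p.1)%:E)%E.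
have mF : measurable_fun setT F.
  have m1 : measurable_fun setT (@fst (measurableTypeR R) T) by exact: measurable_fst.
  have m2 : measurable_fun setT (fun p : measurableTypeR R * T => q p.2).
    by apply: measurableT_comp => //; exact: measurable_snd.
  apply: emeasurable_funM; apply/measurable_EFinP; last first.
    have mI : measurable_fun setT (\1_D : measurableTypeR R -> R).
      exact: measurable_indic.
    exact: (measurableT_comp mI m1).
  apply: measurable_funM.
    exact: (measurableT_comp (measurable_powR (s - 1)) m1).
  apply: measurableT_comp => //; apply: measurable_funN.
  by apply: measurable_funM => //; exact: measurable_funD.
have F0 p : (0 <= F p)%E by rewrite /F -EFinM lee_fin mulr_ge0.
have qa0 y : 0 < q y + a ^+ 2 by rewrite ltr_wpDl// exprn_gt0.
have D_indic (G : R -> \bar R) :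
    (\int[lebesgue_measure]_(t in D) G t =
     \int[lebesgue_measure]_t (G t * (\1_D t)%:E))%E.
  by rewrite integral_mkcond; apply: eq_integral => t _; rewrite patchE indicE;
    case: ifP => _; rewrite ?mule1 ?mule0.
(* Integrating in t first gives the powers of q + a ^+ 2. *)
transitivity (\int[mu]_y \int[lebesgue_measure]_t F (t, y))%E.
  rewrite muleC -ge0_integralZr//; last 3 first.
  - apply/measurable_EFinP; apply: (measurableT_comp (measurable_powR (- s))).
    exact: measurable_funD.
  - by move=> y _; rewrite lee_fin powR_ge0.
  - by apply: integral_ge0 => t _; rewrite lee_fin mulr_ge0 ?powR_ge0 ?expR_ge0.
  by apply: eq_integral => y _; rewrite -eGamma_scale// D_indic.
(* Integrating in y first gives the gamma integral of exponent 1 / 2. *)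
rewrite -(@fubini_tonelli _ _ _ _ _ (@lebesgue_measure R) mu F mF F0).
transitivity (\int[lebesgue_measure]_(t in D)
    ((pi `^ (k%:R / 2))%:E * (t `^ (1 / 2 - 1) * expR (- (t * a ^+ 2)))%:E))%E.
  rewrite D_indic; apply: eq_integral => t _; rewrite indicE.
  case: (boolP (t \in D)) => [tD|tD]; last first.
    rewrite mule0; apply: integral0_eq => y _.
    by rewrite /F /= indicE (negbTE tD) mule0.
  have t0 : 0 < t by move: tD; rewrite inE /D /= in_itv/= andbT.
  rewrite mule1 -EFinM.
  transitivity (\int[mu]_y ((t `^ (s - 1) * expR (- (t * a ^+ 2)))%:E *
      (expR (- (t * q y)))%:E))%E.
    apply: eq_integral => y _; rewrite /F /= indicE tD mule1 -EFinM /h.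
    by rewrite -mulrA -expRD; congr (_ * expR _)%:E; ring.
  rewrite ge0_integralZl//; last 2 first.
  - apply/measurable_EFinP; apply: (measurableT_comp (@measurable_expR R)).
    by apply: measurable_funN; exact: measurable_funM.
  - by rewrite lee_fin mulr_ge0 ?powR_ge0 ?expR_ge0.
  rewrite gq// -EFinM powRM ?pi_ge0 ?invr_ge0 ?ltW//; congr EFin.
  rewrite -[t^-1]powR_inv1 ?ltW// -powRrM.
  rewrite (_ : 1 / 2 - 1 = s - 1 + -1 * (k%:R / 2)); last by rewrite /s -natr1; field.
  rewrite [t `^ (s - 1 + _)]powRD; last by rewrite (gt_eqF t0) implybT.
  ring.
rewrite ge0_integralZl//=; last 3 first.
- apply: measurable_funTS; apply/measurable_EFinP.
  apply: measurable_funM; first exact: measurable_powR.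
  apply: (measurableT_comp (@measurable_expR R)).
  by apply: measurable_funN; exact: measurable_funM.
- by move=> t _; rewrite lee_fin mulr_ge0 ?powR_ge0 ?expR_ge0.
- by rewrite lee_fin powR_ge0.
rewrite eGamma_scale ?exprn_gt0// muleA -EFinM; congr (_%:E * _)%E.
congr (_ * _); rewrite -[a ^+ 2]powR_mulrn ?ltW// -powRrM -[a^-1]powR_inv1 ?ltW//.
by congr (_ `^ _); field.
Qed.

Lemma eGamma1 (R : realType) : eGamma (1 : R) = 1%E.
Proof.
rewrite /eGamma -(integral_exponential_pdf (@ltr01 R)) /exponential_pdf.
transitivity (\int[lebesgue_measure]_(t in `[0%R, +oo[)
    (1 * expR (-1 * t) : R)%:E)%E; last first.
  rewrite integral_mkcond; apply: eq_integral => t _; rewrite /= !patchE.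
  by case: ifP.
rewrite -integral_itv_obnd_cbnd; last first.
  apply: measurable_funTS; apply/measurable_EFinP; apply: measurable_funM => //.
  apply: (measurableT_comp (@measurable_expR R)).
  exact: measurable_funM.
by apply: eq_integral => t _; rewrite subrr powRr0 !mul1r mulN1r.
Qed.

(** A normal density of variance 1 / (2t) has total mass 1. *)
Lemma integral_gauss_scale (R : realType) (t b : R) : 0 < t ->
  (\int[lebesgue_measure]_y (expR (- (t * (y - b) ^+ 2))%R)%:E =
   ((pi / t) `^ (1 / 2))%:E)%E.
Proof.
(* The standard deviation for which the normal density is c exp (- t (y - b)^2). *)
move=> t0; pose s : R := Num.sqrt (2 * t)^-1.
have t2 : 0 < 2 * t by rewrite mulr_gt0.
have s2 : s ^+ 2 *+ 2 = t^-1.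
  by rewrite sqr_sqrtr ?invr_ge0 ?ltW// -mulr_natr; field; rewrite gt_eqF.
have s0 : s != 0 by rewrite gt_eqF// sqrtr_gt0 invr_gt0.
have peak : normal_peak s = ((pi / t) `^ (1 / 2))^-1.
  rewrite /normal_peak div1r powR12_sqrt ?divr_ge0 ?pi_ge0 ?ltW//.
  by congr (Num.sqrt _)^-1; rewrite -mulrnAl s2 mulrC.
have p0 : 0 < normal_peak s by rewrite normal_peak_gt0.
have := integral_normal_pdf b s; under eq_integral do rewrite normal_pdfE// EFinM.
rewrite ge0_integralZl//=; last 3 first.
- by apply/measurable_EFinP; exact: measurable_normal_fun.
- by move=> y _; rewrite lee_fin normal_fun_ge0.
- by rewrite lee_fin ltW.
under eq_integral do rewrite /normal_fun s2 invrK mulNr mulrC.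
move=> /(congr1 (fun z => ((normal_peak s)^-1%:E * z)%E)).
by rewrite muleA -EFinM mulVf ?gt_eqF// mul1e mule1 peak invrK.
Qed.

(** The case k = 1 of [gaussian_mixture] with Gamma(1) = 1: the left-hand side
    is then the integral of 1 / (1 + y^2), that is pi. *)
Lemma eGamma_half (R : realType) : eGamma (1 / 2 : R) = (Num.sqrt pi)%:E.
Proof.
have := @gaussian_mixture _ _ R (@lebesgue_measure R) (fun y => y ^+ 2) 1 1 ltr01.
rewrite -[2%:R / 2]/(2 / 2) divff// eGamma1 mul1e expr1n.
have -> : (\int[lebesgue_measure]_y ((y ^+ 2 + 1) `^ (-1) : R)%:E = pi%:E)%E.
  transitivity (\int[lebesgue_measure]_y ((oneDsqr y)^-1 : R)%:E)%E.
    apply: eq_integral => y _; rewrite powR_inv1 1?addrC//.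
    by rewrite addr_ge0 ?sqr_ge0.
  rewrite ge0_symfun_integralT.
  - by rewrite -set_itvcy integral0y_oneDsqr -EFinM mulrC divfK.
  - by move=> y; rewrite invr_ge0 addr_ge0 ?sqr_ge0.
  - exact: continuous_oneDsqrV.
  - by move=> y; rewrite /= /oneDsqr sqrrN.
have sp0 : 0 < Num.sqrt (pi : R) by rewrite sqrtr_gt0 pi_gt0.
move=> H; have /esym : (pi%:E = (pi `^ (1 / 2) / 1)%:E * eGamma (1 / 2 : R))%E.
  apply: H.
  - exact: measurable_funX.
  - by move=> y; exact: sqr_ge0.
  - move=> t t0; rewrite -(integral_gauss_scale 0 t0).
    by apply: eq_integral => y _; rewrite subr0.
rewrite divr1 div1r powR12_sqrt ?pi_ge0//.
move=> /(congr1 (fun z => ((Num.sqrt pi)^-1%:E * z)%E)).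
rewrite muleA -EFinM mulVf ?gt_eqF// mul1e => ->; rewrite -EFinM; congr EFin.
by rewrite -[X in _ * X]sqr_sqrtr ?pi_ge0// expr2 mulKf// gt_eqF.
Qed.

(** * Gaussian integrals over the boundary and the Poisson kernel *)

Definition sqdist (R : realType) (m : nat) (b : 'I_m -> R) (y : bpoint R m) : R :=
  \sum_(i < m) (tnth y i - b i) ^+ 2.

Lemma sqdist_ge0 (R : realType) (m : nat) (b : 'I_m -> R) (y : bpoint R m) :
  0 <= sqdist b y.
Proof. by apply: sumr_ge0 => i _; exact: sqr_ge0. Qed.

Lemma measurable_sqdist (R : realType) (m : nat) (b : 'I_m -> R) :
  measurable_fun setT (sqdist b).
Proof.
apply: measurable_sum => i; apply: measurable_funX; apply: measurable_funB => //.
exact: measurable_tnth.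
Qed.

Lemma ge0_integral_lebesgue_cons (R : realType) (m : nat) (f : bpoint R m.+1 -> \bar R) :
  measurable_fun setT f -> (forall y, 0 <= f y)%E ->
  (\int[lebesgue_tuple R m.+1]_y f y =
   \int[lebesgue_measure]_a \int[lebesgue_tuple R m]_y f (tuple_cons (a, y)))%E.
Proof.
move=> mf f0.
pose mu := (@lebesgue_measure R \x lebesgue_tuple R m)%E.
have mc := @measurable_tuple_cons R m.
transitivity (\int[mu]_p f (tuple_cons p))%E.
  by rewrite -(@ge0_integral_pushforward _ _ _ _ _ _ mc mu setT f)//.
have mfc : measurable_fun setT (f \o tuple_cons) by exact: measurableT_comp.
exact: (@fubini_tonelli1 _ _ _ _ _ (@lebesgue_measure R) (lebesgue_tuple R m)
  (f \o tuple_cons) mfc (fun p => f0 _)).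
Qed.

Lemma integral_gauss_tuple (R : realType) (m : nat) (t : R) (b : 'I_m -> R) : 0 < t ->
  (\int[lebesgue_tuple R m]_y (expR (- (t * sqdist b y))%R)%:E =
   ((pi / t) `^ (m%:R / 2))%:E)%E.
Proof.
move=> t0.
have mg k (c : 'I_k -> R) : measurable_fun setT (fun y => (expR (- (t * sqdist c y)))%:E).
  apply/measurable_EFinP; apply: (measurableT_comp (@measurable_expR R)).
  by apply: measurable_funN; apply: measurable_funM => //; exact: measurable_sqdist.
have pt0 : 0 < pi / t by rewrite divr_gt0 ?pi_gt0.
elim: m b => [|m IH] b.
  rewrite /= integral_dirac//=; last exact: mg.
  rewrite diracE mem_set// mul1e /sqdist big_ord0.
  by rewrite mulr0 oppr0 expR0 mul0r powRr0.
rewrite ge0_integral_lebesgue_cons//.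
pose b' i := b (lift ord0 i).
transitivity (\int[lebesgue_measure]_a
    (((pi / t) `^ (m%:R / 2))%:E * (expR (- (t * (a - b ord0) ^+ 2)))%:E))%E.
  apply: eq_integral => a _.
  rewrite -(IH b') -ge0_integralZr//; last exact: mg.
  apply: eq_integral => y _; rewrite -EFinM -expRD; congr (expR _)%:E.
  rewrite /sqdist big_ord_recl mulrDr opprD addrC; congr (_ + _).
  by congr (- (t * _)); apply: eq_bigr => i _; rewrite tnthS.
rewrite ge0_integralZl//=; last 2 first.
- apply/measurable_EFinP; apply: (measurableT_comp (@measurable_expR R)).
  apply: measurable_funN; apply: measurable_funM => //; apply: measurable_funX.
  exact: measurable_funB.
- by rewrite lee_fin powR_ge0.
rewrite integral_gauss_scale// -EFinM -powRD; last by rewrite (gt_eqF pt0) implybT.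
by congr (_ `^ _)%:E; rewrite -[m.+1%:R]natr1; field.
Qed.

Definition tangential (R : realType) (m : nat) (x : 'rV[R]_m.+1) (i : 'I_m) : R :=
  x ord0 (widen_ord (leqnSn m) i).

Lemma enorm_ge0 (R : realType) n (x : 'rV[R]_n.+1) : 0 <= enorm x.
Proof. exact: sqrtr_ge0. Qed.

Lemma sqr_enorm (R : realType) n (x : 'rV[R]_n.+1) :
  enorm x ^+ 2 = \sum_i x ord0 i ^+ 2.
Proof. by rewrite sqr_sqrtr// sumr_ge0// => i _; exact: sqr_ge0. Qed.

Lemma sqr_enorm_bembed (R : realType) (m : nat) (x : 'rV[R]_m.+1) (y : bpoint R m) :
  enorm (bembed y - x) ^+ 2 = sqdist (tangential x) y + normal_coord x ^+ 2.
Proof.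
rewrite sqr_enorm big_ord_recr/=; congr (_ + _).
  by apply: eq_bigr => i _; rewrite !mxE /= -tnth_nth.
by rewrite !mxE /= nth_default ?size_tuple// sub0r sqrrN.
Qed.

Lemma enorm_bembed_gt0 (R : realType) (m : nat) (x : 'rV[R]_m.+1) (y : bpoint R m) :
  half_space x -> 0 < enorm (bembed y - x).
Proof.
move=> x0; have : 0 < enorm (bembed y - x) ^+ 2.
  by rewrite sqr_enorm_bembed ltr_wpDl ?sqdist_ge0// exprn_gt0.
by rewrite exprn_even_gt0//= lt_neqAle eq_sym enorm_ge0 andbT => ->.
Qed.

Lemma measurable_enorm_bembed (R : realType) (m : nat) (x : 'rV[R]_m.+1) :
  measurable_fun setT (fun y : bpoint R m => enorm (bembed y - x)).
Proof.
have -> : (fun y : bpoint R m => enorm (bembed y - x)) =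
  (fun y => (sqdist (tangential x) y + normal_coord x ^+ 2) `^ (2^-1)).
  apply/funext => y; rewrite powR12_sqrt.
    by rewrite -sqr_enorm_bembed sqrtr_sqr ger0_norm// enorm_ge0.
  by rewrite addr_ge0 ?sqdist_ge0 ?sqr_ge0.
apply: (measurableT_comp (measurable_powR (2^-1))).
by apply: measurable_funD => //; exact: measurable_sqdist.
Qed.

Lemma measurable_enorm_bembedV (R : realType) (m k : nat) (x : 'rV[R]_m.+1) :
  measurable_fun setT (fun y : bpoint R m => enorm (bembed y - x) ^- k).
Proof.
have -> : (fun y : bpoint R m => enorm (bembed y - x) ^- k) =
    (fun y => enorm (bembed y - x) `^ (- k%:R)).
  by apply/funext => y; rewrite powRN powR_mulrn// enorm_ge0.
apply: (measurableT_comp (measurable_powR (- k%:R))).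
exact: measurable_enorm_bembed.
Qed.

(** The Poisson kernel has total mass 1; the value of omega_n is exactly what
    [gaussian_mixture] produces. A product of two nonnegative extended reals that
    is finite and nonzero has finite and nonzero factors, which is how the
    finiteness of Gamma(n/2) and the positivity of omega_n are obtained. *)
Lemma integral_poisson_kernel (R : realType) (m : nat) (x : 'rV[R]_m.+1) :
  half_space x -> 0 < omega m.+1 :> R /\
  (\int[lebesgue_tuple R m]_y (enorm (bembed y - x) ^- m.+1)%:E =
    (omega m.+1 / 2 / normal_coord x)%:E)%E.
Proof.
rewrite /half_space/= => x0; set a := normal_coord x in x0 *.
pose s : R := m.+1%:R / 2.
pose I : \bar R := (\int[lebesgue_tuple R m]_y
  ((sqdist (tangential x) y + a ^+ 2) `^ (- s))%:E)%E.
have -> : (\int[lebesgue_tuple R m]_y (enorm (bembed y - x) ^- m.+1)%:E = I)%E.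
  apply: eq_integral => y _; rewrite -sqr_enorm_bembed -[in RHS]powR_mulrn ?enorm_ge0//.
  by rewrite -powRrM mulrN mulrC divfK// powRN powR_mulrn// enorm_ge0.
have /(_ x0) : 0 < a -> (eGamma s * I = (pi `^ (m%:R / 2) / a)%:E * eGamma (1 / 2)%R)%E.
  move=> _; apply: gaussian_mixture => //.
  - exact: measurable_sqdist.
  - exact: sqdist_ge0.
  - by move=> t t0; rewrite integral_gauss_tuple.
rewrite eGamma_half -EFinM.
have -> : pi `^ (m%:R / 2) / a * Num.sqrt pi = pi `^ s / a :> R.
  rewrite -powR12_sqrt ?pi_ge0// mulrAC -powRD ?(gt_eqF (pi_gt0 R)) ?implybT//.
  by congr (_ `^ _ / _); rewrite /s -natr1; field.
have c0 : 0 < pi `^ s / a :> R by rewrite divr_gt0// powR_gt0// pi_gt0.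
have G0 : (0 <= eGamma s)%E.
  by apply: integral_ge0 => t _; rewrite lee_fin mulr_ge0 ?powR_ge0 ?expR_ge0.
have I0 : (0 <= I)%E by apply: integral_ge0 => y _; rewrite lee_fin powR_ge0.
have GE : Gamma s = fine (eGamma s) by [].
move: c0; rewrite /omega -/s GE; move: (pi `^ s) => p.
case: (eGamma s) G0 => [g| |]// G0.
  case: I I0 => [i| |]// I0.
    rewrite -EFinM => p0 [gi] /=.
    have g0 : 0 < g.
      rewrite lt_neqAle -lee_fin G0 andbT eq_sym.
      by apply: contraTN p0 => /eqP g0; rewrite -gi g0 mul0r ltxx.
    have pp : p = g * i * a by rewrite gi divfK// gt_eqF.
    have i0 : 0 < i by rewrite -(pmulr_rgt0 _ g0) gi.
    split; first by rewrite divr_gt0// pp !mulr_gt0.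
    by congr EFin; rewrite pp; field; rewrite !gt_eqF.
  move=> p0; have [->|g0] := eqVneq g 0.
    by rewrite mul0e => -[e]; move: p0; rewrite -e ltxx.
  by rewrite gt0_muley// lte_fin lt_neqAle eq_sym g0 -lee_fin.
case: I I0 => [i| |]// I0 p0.
have [->|i0] := eqVneq i 0.
  by rewrite mule0 => -[e]; move: p0; rewrite -e ltxx.
by rewrite gt0_mulye// lte_fin lt_neqAle eq_sym i0 -lee_fin.
Qed.

(** * The essential supremum norm and the constant function *)

(** The norm of exponent +oo is set to 0 on a space of measure zero, hence the
    need for this. *)
Lemma lebesgue_tupleT_gt0 (R : realType) (m : nat) :
  (0 < lebesgue_tuple R m setT)%E.
Proof.
have := @lebesgue_tuple_box R m (fun=> setT) (fun=> measurableT).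
have -> : [set y : bpoint R m | forall i, [set: R] (tnth y i)] = setT.
  by apply/seteqP; split.
move=> ->.
elim/big_ind : _ => // [a b|i _]; first exact: mule_gt0.
by rewrite -set_itvNyy lebesgue_measure_itv/= ltry.
Qed.

Lemma supnorm_ge0 (R : realType) m (f : bpoint R m -> R) : 0 <= supnorm f.
Proof. by apply: fine_ge0; exact: Lnorm_ge0. Qed.

Lemma ae_le_supnorm (R : realType) m (f : bpoint R m -> R) :
  f \in Lfun (lebesgue_tuple R m) +oo%E ->
  {ae lebesgue_tuple R m, forall y, `|f y| <= supnorm f}.
Proof.
move=> /andP[_ /set_mem]; rewrite /= /finite_norm => foo.
have fE : ('N[lebesgue_tuple R m]_+oo [EFin \o f])%E = (supnorm f)%:E.
  by rewrite fineK// ge0_fin_numE// Lnorm_ge0.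
rewrite unlock /= lebesgue_tupleT_gt0 in fE.
have := @ess_sup_ge _ _ _ (lebesgue_tuple R m) (abse \o (EFin \o f)).
rewrite fE; apply: filterS => y /=.
by rewrite lee_fin.
Qed.

Lemma Linfnorm_cst1 (R : realType) m :
  ('N[lebesgue_tuple R m]_+oo [EFin \o cst 1%R] = 1)%E.
Proof.
rewrite unlock lebesgue_tupleT_gt0 -[RHS](ess_sup_cst _ (lebesgue_tupleT_gt0 R m)).
by congr ess_sup; apply/funext => y /=; rewrite normr1.
Qed.

Lemma Lfun_cst1 (R : realType) m : cst 1 \in Lfun (lebesgue_tuple R m) +oo%E.
Proof.
apply/andP; split; first by apply/mem_set; exact: measurable_cst.
by apply/mem_set; rewrite /= /finite_norm Linfnorm_cst1 ltry.
Qed.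

Lemma supnorm_cst1 (R : realType) m : supnorm (cst 1 : bpoint R m -> R) = 1.
Proof. by rewrite /supnorm Linfnorm_cst1. Qed.

Lemma harmonic_cst (R : realType) n (U : set 'rV[R]_n.+1) (c : R) : harmonic_on U (cst c).
Proof.
have p0 i (k : R) : partial i (cst k) = cst 0 :> ('rV[R]_n.+1 -> R).
  by apply/funext => x; rewrite /partial derive_cst.
split=> [x _|x _]; last first.
  by rewrite /laplacian big1// => i _; rewrite !p0.
split => [|i|i j]; rewrite ?p0; try exact: differentiable_cst.
by move=> ?; exact: cst_continuous.
Qed.

(** The extremal function. *)
Lemma hinfty_cst1 (R : realType) m :
  hinfty (cst 1 : 'rV[R]_m.+1 -> R) (cst 1).
Proof.
split; [exact: harmonic_cst|exact: Lfun_cst1|move=> x hx].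
have [w0 Hi] := integral_poisson_kernel hx.
rewrite /poisson /Rintegral.
have x0 : 0 < normal_coord x by [].
transitivity (2 / omega m.+1 * fine (\int[lebesgue_tuple R m]_y
    ((normal_coord x)%:E * (enorm (bembed y - x) ^- m.+1)%:E))%E); last first.
  by congr (_ * fine _); apply: eq_integral => y _; rewrite mulr1 EFinM.
rewrite ge0_integralZl//=.
- by rewrite Hi -EFinM/=; field; rewrite !gt_eqF.
- by apply/measurable_EFinP; exact: measurable_enorm_bembedV.
- by move=> y _; rewrite lee_fin invr_ge0 exprn_ge0 ?enorm_ge0.
- by rewrite lee_fin ltW.
Qed.

(** * The kernel of the weighted Poisson integral and its derivative *)

Lemma cauchy_schwarz (R : realFieldType) (k : nat) (a b : 'I_k -> R) :
  (\sum_i a i * b i) ^+ 2 <= (\sum_i a i ^+ 2) * (\sum_i b i ^+ 2).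
Proof.
set A := \sum_i a i ^+ 2; set B := \sum_i b i ^+ 2; set D := \sum_i a i * b i.
have B0 : 0 <= B by apply: sumr_ge0 => i _; exact: sqr_ge0.
have [Bz|Bn] := eqVneq B 0.
  have bz i : b i = 0.
    apply/eqP; rewrite -sqrf_eq0; move/eqP : Bz; rewrite psumr_eq0; last first.
      by move=> j _; exact: sqr_ge0.
    by move=> /allP /(_ i); rewrite mem_index_enum => /(_ isT).
  by rewrite Bz mulr0 /D big1 ?expr0n// => i _; rewrite bz mulr0.
have : 0 <= \sum_i (B * a i - D * b i) ^+ 2.
  by apply: sumr_ge0 => i _; exact: sqr_ge0.
have -> : \sum_i (B * a i - D * b i) ^+ 2 = B * (A * B - D ^+ 2).
  transitivity (\sum_i (B ^+ 2 * a i ^+ 2 - 2 * B * D * (a i * b i) + D ^+ 2 * b i ^+ 2)).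
    by apply: eq_bigr => i _; ring.
  by rewrite big_split/= sumrB -!mulr_sumr -/A -/B -/D; ring.
by rewrite pmulr_rge0 ?subr_ge0// lt_neqAle eq_sym Bn.
Qed.

Definition dotv (R : realType) n (u v : 'rV[R]_n.+1) : R :=
  \sum_i u ord0 i * v ord0 i.

(** Up to a positive factor, the derivative along [z] of the kernel
    (x_n / |y - x|)^n. If xi is the tangential part of y - x, it equals
    z_n |xi|^2 + x_n <xi, z>: the contributions of x_n^2 cancel. *)
Definition slope (R : realType) m (x z : 'rV[R]_m.+1) (y : bpoint R m) : R :=
  normal_coord z * enorm (bembed y - x) ^+ 2
  + normal_coord x * dotv (bembed y - x) z.

(** With q = |xi|^2, A the slope and L = |z|, the inequality
    2 |A| L q <= A^2 + L^2 q^2 is an equality for the normal direction, where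
    A = L q. Bounding the square of A = z_n q + x_n <xi, z> by the Cauchy-Schwarz
    inequality <xi, z>^2 <= q (L^2 - z_n^2) leaves a right-hand side that is again
    a combination of A and |y - x|^2, and q cancels. *)
Lemma slope_bound (R : realType) m (x z : 'rV[R]_m.+1) (y : bpoint R m) :
  `|slope x z y| * enorm z <= normal_coord z * slope x z y
    + (enorm z ^+ 2 - normal_coord z ^+ 2) / 2 * enorm (bembed y - x) ^+ 2.
Proof.
rewrite /slope sqr_enorm_bembed; set q := sqdist _ _; set N := normal_coord x.
set zn := normal_coord z; set L := enorm z.
pose t := \sum_(i < m) (tnth y i - tangential x i) * tangential z i.
have -> : dotv (bembed y - x) z = t - N * zn.
  rewrite /dotv big_ord_recr/=; congr (_ + _).
    by apply: eq_bigr => i _; rewrite !mxE/= -tnth_nth.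
  by rewrite !mxE/= nth_default ?size_tuple// sub0r mulNr.
have q0 : 0 <= q by exact: sqdist_ge0.
have L2 : L ^+ 2 - zn ^+ 2 = \sum_(i < m) tangential z i ^+ 2.
  by rewrite /L sqr_enorm big_ord_recr/= addrK.
have cs : t ^+ 2 <= q * (L ^+ 2 - zn ^+ 2) by rewrite L2; exact: cauchy_schwarz.
have L0 : 0 <= L by exact: enorm_ge0.
have znL : 0 <= L ^+ 2 - zn ^+ 2 by rewrite L2 sumr_ge0// => i _; exact: sqr_ge0.
have -> : zn * (q + N ^+ 2) + N * (t - N * zn) = zn * q + N * t by ring.
set A := zn * q + N * t.
(* At the projection of x on the boundary the slope vanishes. *)
have [qz|qn] := eqVneq q 0.
  have tz : t = 0.
    by apply/eqP; rewrite -sqrf_eq0 eq_le sqr_ge0 andbT (le_trans cs)// qz mul0r.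
  rewrite /A qz tz !mulr0 addr0 normr0 mul0r mulr0 add0r.
  by rewrite mulr_ge0 ?divr_ge0// addr_ge0// sqr_ge0.
have qp : 0 < q by rewrite lt_neqAle eq_sym qn.
rewrite -(ler_pM2r qp).
have H1 : 2 * (`|A| * (L * q)) <= A ^+ 2 + (L * q) ^+ 2.
  have := sqr_ge0 (`|A| - L * q); rewrite sqrrB real_normK ?num_real//.
  by rewrite -mulr_natl; lra.
have H2 : A ^+ 2 <= zn ^+ 2 * q ^+ 2 + 2 * zn * q * N * t
    + N ^+ 2 * (q * (L ^+ 2 - zn ^+ 2)).
  by rewrite /A; have := ler_wpM2l (sqr_ge0 N) cs; lra.
move: H1 H2; rewrite /A; lra.
Qed.

Lemma normal_coord_le (R : realType) m (x : 'rV[R]_m.+1) : `|normal_coord x| <= enorm x.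
Proof.
rewrite -[leRHS]ger0_norm ?enorm_ge0// -ler_sqr ?nnegrE// !real_normK ?num_real//.
by rewrite sqr_enorm big_ord_recr/= lerDr sumr_ge0// => i _; exact: sqr_ge0.
Qed.

Lemma normal_coord_le_dist (R : realType) m (x : 'rV[R]_m.+1) y :
  normal_coord x <= enorm (bembed y - x).
Proof.
apply: le_trans (ler_norm _) _.
rewrite -[leRHS]ger0_norm ?enorm_ge0// -ler_sqr ?nnegrE// !real_normK ?num_real//.
by rewrite sqr_enorm_bembed lerDr sqdist_ge0.
Qed.

(** A crude bound, sufficient for domination. *)
Lemma slope_le (R : realType) m (x z : 'rV[R]_m.+1) (y : bpoint R m) :
  half_space x -> `|slope x z y| <= 2 * enorm z * enorm (bembed y - x) ^+ 2.
Proof.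
move=> hx; have x0 : 0 < normal_coord x by [].
set r := enorm (bembed y - x); have r0 : 0 <= r by exact: enorm_ge0.
have d : `|dotv (bembed y - x) z| <= r * enorm z.
  rewrite -[leRHS]ger0_norm ?mulr_ge0 ?enorm_ge0// -ler_sqr ?nnegrE//.
  rewrite !real_normK ?num_real// exprMn /r !sqr_enorm. exact: cauchy_schwarz.
have Nr : normal_coord x <= r by exact: normal_coord_le_dist.
rewrite /slope -/r; apply: le_trans (ler_normD _ _) _.
rewrite !normrM (ger0_norm (ltW x0)).
rewrite (ger0_norm r0).
have H1 := ler_wpM2r (sqr_ge0 r) (normal_coord_le z).
have H2 : normal_coord x * `|dotv (bembed y - x) z| <= r * (r * enorm z).
  by rewrite ler_pM ?(ltW x0).
move: H1 H2; rewrite expr2; lra.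
Qed.

Lemma is_derive_ratio_sqrt (R : realType) (u Q : R -> R) (h du dQ : R) (n : nat) :
  is_derive h 1 u du -> is_derive h 1 Q dQ -> 0 < Q h ->
  is_derive h 1 (fun t => (u t / Num.sqrt (Q t)) ^+ n.+1)
    (n.+1%:R * (u h / Num.sqrt (Q h)) ^+ n
     * ((du * Q h - u h * dQ / 2) / Num.sqrt (Q h) ^+ 3)).
Proof.
move=> Hu HQ Q0; pose r := Num.sqrt (Q h).
have r0 : 0 < r by rewrite sqrtr_gt0.
have Hs : is_derive h 1 (fun t => Num.sqrt (Q t)) ((2 * r)^-1 * dQ).
  by apply: is_derive1_comp; exact: is_derive1_sqrt.
have Hi : is_derive h 1 (fun t => (Num.sqrt (Q t))^-1) (- r ^- 2 *: ((2 * r)^-1 * dQ)).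
  by apply: is_deriveV; rewrite gt_eqF.
have HX := is_deriveX n.+1 (is_deriveM Hu Hi).
have -> : (fun t => (u t / Num.sqrt (Q t)) ^+ n.+1) =
    (u * (fun t => (Num.sqrt (Q t))^-1)) ^+ n.+1.
  by apply/funext => t; rewrite exprfctE.
apply: (is_derive_eq HX).
rewrite /= -[Num.sqrt (Q h)]/r.
have -> : Q h = r ^+ 2 by rewrite sqr_sqrtr// ltW.
rewrite /GRing.scale/= -[(u * _) h]/(u h * r^-1).
by field; rewrite gt_eqF.
Qed.

Lemma is_derive_affine (R : realType) (a b h : R) :
  is_derive h 1 (fun t => a + t * b) b.
Proof.
have -> : (fun t => a + t * b) = cst a + b \*: (@id R).
  by apply/funext => t; rewrite /= mulrC.
by apply: is_derive_eq; rewrite add0r /GRing.scale/= mulr1.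
Qed.

Lemma is_derive_quadratic (R : realType) (a b c h : R) :
  is_derive h 1 (fun t => a - 2 * t * b + t ^+ 2 * c) (- 2 * b + 2 * h * c).
Proof.
have -> : (fun t => a - 2 * t * b + t ^+ 2 * c) =
    (cst a - (2 * b) \*: (@id R)) + c \*: ((@id R) ^+ 2).
  by apply/funext => t; rewrite !fctE/= -[_ *: t]/(_ * _) -[_ *: t ^+ 2]/(_ * _); ring.
apply: is_derive_eq; rewrite /GRing.scale/= expr1; ring.
Qed.

Lemma normal_coord_line (R : realType) m (x z : 'rV[R]_m.+1) (t : R) :
  normal_coord (x + t *: z) = normal_coord x + t * normal_coord z.
Proof. by rewrite /normal_coord !mxE. Qed.

Lemma sqr_enorm_line (R : realType) m (w x z : 'rV[R]_m.+1) (t : R) :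
  enorm (w - (x + t *: z)) ^+ 2 =
  enorm (w - x) ^+ 2 - 2 * t * dotv (w - x) z + t ^+ 2 * enorm z ^+ 2.
Proof.
rewrite !sqr_enorm /dotv !mulr_sumr -sumrB -big_split/=.
by apply: eq_bigr => i _; rewrite !mxE; ring.
Qed.

Lemma dotv_line (R : realType) m (w x z : 'rV[R]_m.+1) (t : R) :
  dotv (w - (x + t *: z)) z = dotv (w - x) z - t * enorm z ^+ 2.
Proof.
rewrite !sqr_enorm /dotv !mulr_sumr -sumrB.
by apply: eq_bigr => i _; rewrite !mxE; ring.
Qed.

Definition kernel (R : realType) m (x : 'rV[R]_m.+1) (y : bpoint R m) : R :=
  (normal_coord x / enorm (bembed y - x)) ^+ m.+1.

Definition dkernel (R : realType) m (z x : 'rV[R]_m.+1) (y : bpoint R m) : R :=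
  m.+1%:R * (normal_coord x / enorm (bembed y - x)) ^+ m
  * (slope x z y / enorm (bembed y - x) ^+ 3).

Lemma is_derive_kernel (R : realType) m (x z : 'rV[R]_m.+1) (y : bpoint R m) (h : R) :
  half_space (x + h *: z) ->
  is_derive h 1 (fun t => kernel (x + t *: z) y) (dkernel z (x + h *: z) y).
Proof.
move=> hx.
pose Q t := enorm (bembed y - x) ^+ 2 - 2 * t * dotv (bembed y - x) z
  + t ^+ 2 * enorm z ^+ 2.
have QE t : Num.sqrt (Q t) = enorm (bembed y - (x + t *: z)).
  by rewrite /Q -sqr_enorm_line sqrtr_sqr ger0_norm// enorm_ge0.
have Q2 t : Q t = enorm (bembed y - (x + t *: z)) ^+ 2 by rewrite /Q -sqr_enorm_line.
have := @is_derive_ratio_sqrt R _ Q h _ _ m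
  (is_derive_affine (normal_coord x) (normal_coord z) h)
  (is_derive_quadratic (enorm (bembed y - x) ^+ 2) (dotv (bembed y - x) z)
    (enorm z ^+ 2) h).
have Qh0 : 0 < Q h by rewrite Q2 exprn_gt0 ?enorm_bembed_gt0.
move=> /(_ Qh0).
have -> : (fun t => ((normal_coord x + t * normal_coord z) / Num.sqrt (Q t)) ^+ m.+1) =
  (fun t => kernel (x + t *: z) y).
  by apply/funext => t; rewrite /kernel QE normal_coord_line.
move/is_derive_eq; apply.
rewrite /dkernel /slope QE Q2 dotv_line normal_coord_line; congr (_ * (_ / _)).
by field.
Qed.

(** * Integrability *)

Lemma integrable_mul_Lfun (R : realType) m (g f : bpoint R m -> R) :
  f \in Lfun (lebesgue_tuple R m) +oo%E ->
  (lebesgue_tuple R m).-integrable setT (EFin \o g) ->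
  (lebesgue_tuple R m).-integrable setT (EFin \o (fun y => g y * f y)) /\
  `|\int[lebesgue_tuple R m]_y (g y * f y)| <=
    \int[lebesgue_tuple R m]_y `|g y| * supnorm f.
Proof.
move=> fL ig.
have mf : measurable_fun setT f by move: (fL) => /andP[/set_mem].
have mg : measurable_fun setT g.
  by have /measurable_int/measurable_EFinP := ig.
have mgf : measurable_fun setT (fun y => g y * f y) by exact: measurable_funM.
have iag : (lebesgue_tuple R m).-integrable setT (EFin \o (Num.norm \o g)).
  exact: integrable_norm.
have le : (\int[lebesgue_tuple R m]_y `|(g y * f y)%:E| <=
    \int[lebesgue_tuple R m]_y (`|g y| * supnorm f)%:E)%E.
  apply: ae_ge0_le_integral => //.
  - by apply: measurableT_comp => //; apply/measurable_EFinP.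
  - by move=> y _; rewrite lee_fin mulr_ge0 ?supnorm_ge0.
  - apply/measurable_EFinP; apply: measurable_funM => //.
    exact: measurableT_comp.
  - apply: filterS (ae_le_supnorm fL) => y fy _.
    by rewrite lee_fin normrM ler_wpM2l.
have iagM : (lebesgue_tuple R m).-integrable setT (EFin \o (fun y => `|g y| * supnorm f)).
  by apply: eq_integrable (integrableZr measurableT (supnorm f) iag).
have igf : (lebesgue_tuple R m).-integrable setT (EFin \o (fun y => g y * f y)).
  apply/integrableP; split; first by apply/measurable_EFinP.
  apply: le_lt_trans le _.
  have /integrableP[_] := iagM.
  apply: le_lt_trans; apply: ge0_le_integral => //.
  - by move=> y _; rewrite lee_fin mulr_ge0 ?supnorm_ge0.
  - by have /measurable_int := iagM.
  - by apply: measurableT_comp => //; have /measurable_int := iagM.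
  - by move=> y _ /=; rewrite lee_fin ler_norm.
split => //; apply: le_trans (le_normr_Rintegral _ igf) _ => //.
rewrite -RintegralZr//.
apply: fine_le => //.
- by have := integrable_fin_num measurableT (integrable_norm igf).
- by have := integrable_fin_num measurableT iagM.
Qed.

Lemma integrable_dist (R : realType) m (x : 'rV[R]_m.+1) : half_space x ->
  (lebesgue_tuple R m).-integrable setT
    (EFin \o (fun y => enorm (bembed y - x) ^- m.+1)).
Proof.
move=> hx; apply/integrableP; split.
  by apply/measurable_EFinP; exact: measurable_enorm_bembedV.
under eq_integral do rewrite gee0_abs ?lee_fin ?invr_ge0 ?exprn_ge0 ?enorm_ge0//.
by have [_ ->] := integral_poisson_kernel hx; rewrite ltry.
Qed.

Lemma measurable_bembed (R : realType) m (i : 'I_m.+1) :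
  measurable_fun setT (fun y : bpoint R m => bembed y ord0 i).
Proof.
have -> : (fun y : bpoint R m => bembed y ord0 i) = (fun y : bpoint R m => nth 0 y i).
  by apply/funext => y; rewrite mxE.
case: (ltnP i m) => im.
  have -> : (fun y : bpoint R m => nth 0 y i) = (fun y => tnth y (Ordinal im)).
    by apply/funext => y; rewrite (tnth_nth 0).
  exact: measurable_tnth.
have -> : (fun y : bpoint R m => nth 0 y i) = cst 0.
  by apply/funext => y; rewrite nth_default// size_tuple.
exact: measurable_cst.
Qed.

Lemma measurable_slope (R : realType) m (x z : 'rV[R]_m.+1) :
  measurable_fun setT (slope x z).
Proof.
apply: measurable_funD; apply: measurable_funM => //.
  by apply: measurable_funX; exact: measurable_enorm_bembed.
apply: measurable_sum => i; apply: measurable_funM => //.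
under eq_fun do rewrite mxE.
by apply: measurable_funD => //; exact: measurable_bembed.
Qed.

Lemma kernelE (R : realType) m (x : 'rV[R]_m.+1) (y : bpoint R m) :
  kernel x y = normal_coord x ^+ m.+1 * enorm (bembed y - x) ^- m.+1.
Proof. by rewrite /kernel expr_div_n. Qed.

Lemma integrable_kernel (R : realType) m (x : 'rV[R]_m.+1) : half_space x ->
  (lebesgue_tuple R m).-integrable setT (EFin \o kernel x).
Proof.
move=> hx.
apply: eq_integrable (integrableZl measurableT (normal_coord x ^+ m.+1)
  (integrable_dist hx)) => //.
by move=> y _ /=; rewrite kernelE EFinM.
Qed.

Lemma dkernelE (R : realType) m (z x : 'rV[R]_m.+1) (y : bpoint R m) : half_space x ->
  dkernel z x y = m.+1%:R * normal_coord x ^+ m *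
    (enorm (bembed y - x) ^- m.+1 * (slope x z y / enorm (bembed y - x) ^+ 2)).
Proof.
move=> hx; have r0 := enorm_bembed_gt0 y hx; rewrite /dkernel expr_div_n [_ ^+ m.+1]exprS.
by field; rewrite expf_neq0 ?gt_eqF.
Qed.

Lemma dkernel_le (R : realType) m (z x : 'rV[R]_m.+1) (y : bpoint R m) : half_space x ->
  `|dkernel z x y| <= 2 * m.+1%:R * enorm z * normal_coord x ^+ m
    * enorm (bembed y - x) ^- m.+1.
Proof.
move=> hx; have r0 := enorm_bembed_gt0 y hx; have x0 : 0 < normal_coord x by [].
rewrite dkernelE// !normrM ger0_norm// ger0_norm ?exprn_ge0 ?(ltW x0)//.
set r := enorm _ in r0 *.
rewrite !normfV (ger0_norm (exprn_ge0 _ (ltW r0))) (ger0_norm (exprn_ge0 2 (ltW r0))).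
have H : `|slope x z y| / r ^+ 2 <= 2 * enorm z.
  by rewrite ler_pdivrMr ?exprn_gt0//; exact: slope_le.
have C0 : 0 <= m.+1%:R * normal_coord x ^+ m * r ^- m.+1.
  by rewrite !mulr_ge0 ?invr_ge0 ?exprn_ge0 ?(ltW r0) ?(ltW x0).
by have := ler_wpM2l C0 H; lra.
Qed.

Lemma integrable_dkernel (R : realType) m (z x : 'rV[R]_m.+1) : half_space x ->
  (lebesgue_tuple R m).-integrable setT (EFin \o dkernel z x).
Proof.
move=> hx.
apply: le_integrable (integrableZl measurableT
  (2 * m.+1%:R * enorm z * normal_coord x ^+ m) (integrable_dist hx)) => //.
  apply/measurable_EFinP.
  have -> : dkernel z x = fun y => m.+1%:R * normal_coord x ^+ m *
    (enorm (bembed y - x) ^- m.+1 * (slope x z y * enorm (bembed y - x) ^- 2)).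
    by apply/funext => y; rewrite dkernelE.
  apply: measurable_funM => //; apply: measurable_funM.
    exact: measurable_enorm_bembedV.
  by apply: measurable_funM; [exact: measurable_slope|exact: measurable_enorm_bembedV].
move=> y _ /=; rewrite lee_fin; apply: le_trans (dkernel_le z y hx) _.
by rewrite ler_norm.
Qed.

(** * Differentiation under the integral sign *)

(** Moving [x] by at most half its height at most halves the distance to any
    boundary point, since that distance is never below the height. *)
Lemma half_space_line (R : realType) m (x z : 'rV[R]_m.+1) (h : R) (y : bpoint R m) :
  half_space x -> `|h| * enorm z <= normal_coord x / 2 ->
  [/\ half_space (x + h *: z),
      normal_coord (x + h *: z) <= 2 * normal_coord x &
      enorm (bembed y - x) <= 2 * enorm (bembed y - (x + h *: z))].
Proof.
move=> hx hz; have x0 : 0 < normal_coord x by [].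
set N := normal_coord x in x0 hz *; set Nh := normal_coord (x + h *: z).
have dN : `|Nh - N| <= N / 2.
  rewrite /Nh normal_coord_line -/N addrAC subrr add0r normrM.
  by apply: le_trans hz; rewrite ler_wpM2l// normal_coord_le.
have [N1 N2] : N / 2 <= Nh /\ Nh <= 2 * N.
  by move: dN; rewrite ler_norml => /andP[]; lra.
have hxh : half_space (x + h *: z) by apply: lt_le_trans N1; rewrite divr_gt0.
split => //.
set r := enorm _; set rh := enorm (bembed y - (x + h *: z)).
have rh0 : 0 <= rh by exact: enorm_ge0.
have Nrh : N / 2 <= rh by apply: le_trans N1 _; exact: normal_coord_le_dist.
rewrite -(@ler_pXn2r _ 2)// ?nnegrE ?enorm_ge0// ?mulr_ge0//.
have E := sqr_enorm_line (bembed y) x z h.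
(* |a + b|^2 <= 2 |a|^2 + 2 |b|^2, from |a - b|^2 >= 0. *)
have S : r ^+ 2 <= 2 * rh ^+ 2 + 2 * (`|h| * enorm z) ^+ 2.
  have : 0 <= \sum_i ((bembed y - x) ord0 i - 2 * h * z ord0 i) ^+ 2.
    by apply: sumr_ge0 => i _; exact: sqr_ge0.
  have -> : \sum_i ((bembed y - x) ord0 i - 2 * h * z ord0 i) ^+ 2 =
     r ^+ 2 - 4 * h * dotv (bembed y - x) z + 4 * h ^+ 2 * enorm z ^+ 2.
    rewrite !sqr_enorm /dotv !mulr_sumr -sumrB -big_split/=.
    by apply: eq_bigr => i _; ring.
  by rewrite exprMn real_normK ?num_real// /rh E -/r; lra.
have hz2 : (`|h| * enorm z) ^+ 2 <= (N / 2) ^+ 2.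
  by rewrite ler_pXn2r// nnegrE ?mulr_ge0 ?enorm_ge0// ltW.
have Nr2 : (N / 2) ^+ 2 <= rh ^+ 2.
  by rewrite ler_pXn2r// nnegrE ?divr_ge0// ltW.
by rewrite exprMn; lra.
Qed.

Lemma cvg_integral_kernel (R : realType) m (x z : 'rV[R]_m.+1) (f : bpoint R m -> R) :
  half_space x -> f \in Lfun (lebesgue_tuple R m) +oo%E ->
  h^-1 *: (\int[lebesgue_tuple R m]_y (kernel (x + h *: z) y * f y) -
           \int[lebesgue_tuple R m]_y (kernel x y * f y)) @[h --> 0^'] -->
  \int[lebesgue_tuple R m]_y (dkernel z x y * f y).
Proof.
move=> hx fL; have x0 : 0 < normal_coord x by [].
set N := normal_coord x in x0.
(* The denominator is shifted by 1 so that z = 0 is not a special case. *)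
pose d := N / 2 / (enorm z + 1).
have z1 : 0 < enorm z + 1 by rewrite ltr_wpDl ?enorm_ge0.
have d0 : 0 < d by rewrite !divr_gt0.
pose k (h : R) y := kernel (x + h *: z) y * f y.
have Id (h : R) : h \in `](- d), d[ -> `|h| * enorm z <= N / 2.
  rewrite in_itv/= -ltr_norml => hd.
  apply: le_trans (_ : d * enorm z <= _); first by rewrite ler_wpM2r ?enorm_ge0// ltW.
  rewrite /d mulrAC ler_pdivrMr// ler_wpM2l ?divr_ge0 ?(ltW x0)//; lra.
have I0 : (`]-d, d[%classic : set R) 0 by rewrite /= in_itv/= oppr_lt0 d0.
(* On the interval the height at most doubles and the distance at most halves,
   which turns the bound of dkernel_le into one that is uniform in h. *)
pose C := 2 * m.+1%:R * enorm z * (2 * N) ^+ m * 2 ^+ m.+1.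
have C0 : 0 <= C.
  by rewrite /C !mulr_ge0 ?exprn_ge0 ?enorm_ge0 ?mulr_ge0 ?(ltW x0).
pose G (y : bpoint R m) : R := `|C * enorm (bembed y - x) ^- m.+1 * f y|.
have dk (h : R) y : h \in `](- d), d[ ->
    is_derive h 1 (k^~ y) (dkernel z (x + h *: z) y * f y).
  move=> /Id hd; have [hxh _ _] := half_space_line y hx hd.
  have H := is_derive_kernel y hxh.
  rewrite /k (_ : (fun t => _) = f y \*: (fun t => kernel (x + t *: z) y)).
    by apply: (is_derive_eq (is_deriveZ (f y) H)); rewrite mulrC.
  by apply/funext => t; rewrite /= mulrC.
have d1k h y : h \in `](- d), d[ -> partial1of2 k h y = dkernel z (x + h *: z) y * f y.
  by move=> /dk Hd; rewrite partial1of2E; have := Hd y => {}Hd; rewrite derive_val.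
have intk h : (`]-d, d[%classic : set R) h ->
    (lebesgue_tuple R m).-integrable setT (EFin \o k h).
  move=> /Id hd; have [hxh _ _] := half_space_line [tuple of nseq m 0] hx hd.
  by have [] := integrable_mul_Lfun fL (integrable_kernel hxh).
have derk h y : (`]-d, d[%classic : set R) h -> [set: bpoint R m] y ->
    derivable (k^~ y) h 1.
  by move=> /(dk _ y) ? _; exact: ex_derive.
have intG : (lebesgue_tuple R m).-integrable setT (EFin \o G).
  apply: integrable_norm => //.
  have iC := integrableZl measurableT C (integrable_dist hx).
  by have [] := integrable_mul_Lfun
    (g := fun y => C * enorm (bembed y - x) ^- m.+1) fL iC.
have Gub h y : (`]-d, d[%classic : set R) h -> [set: bpoint R m] y ->
    `|partial1of2 k h y| <= G y.
  move=> hI _; rewrite d1k// /G normrM [leRHS]normrM ler_wpM2r//.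
  have [hxh Nh rh] := half_space_line y hx (Id _ hI).
  apply: le_trans (dkernel_le z y hxh) _; apply: le_trans (ler_norm _).
  set Nh' := normal_coord _ in Nh *; set r := enorm (bembed y - x) in rh *.
  set r' := enorm (_ - _) in rh *.
  have r0 : 0 < r by exact: enorm_bembed_gt0.
  have r'0 : 0 < r' by exact: enorm_bembed_gt0.
  have Nh0 : 0 < Nh' by [].
  have P1 : Nh' ^+ m <= (2 * N) ^+ m by rewrite lerXn2r// nnegrE ltW// (lt_le_trans Nh0).
  have P2 : r' ^- m.+1 <= 2 ^+ m.+1 * r ^- m.+1.
    rewrite -expr_div_n -exprVn lerXn2r ?nnegrE ?divr_ge0 ?invr_ge0 ?(ltW r0) ?(ltW r'0)//.
    by rewrite ler_pdivlMr// mulrC ler_pdivrMr.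
  rewrite /C -!mulrA; do 3! (rewrite ler_wpM2l ?enorm_ge0//).
  by rewrite ler_pM ?exprn_ge0 ?invr_ge0 ?exprn_ge0 ?(ltW r'0) ?(ltW Nh0).
have := @cvg_differentiation_under_integral R _ (bpoint R m) (lebesgue_tuple R m) k setT
  measurableT 0 (- d) d I0 intk derk G (fun y => normr_ge0 _) intG Gub.
have -> : \int[lebesgue_tuple R m]_(y in setT) partial1of2 k 0 y =
    \int[lebesgue_tuple R m]_y (dkernel z x y * f y).
  by apply: eq_Rintegral => y _; rewrite d1k// scale0r addr0.
apply: cvg_trans; apply: near_eq_cvg; apply: nearW => h.
rewrite addr0; congr (_ *: (_ - _)).
by apply: eq_Rintegral => y _; rewrite /k scale0r addr0.
Qed.

(** The weight x_n^m completes the factor x_n of the Poisson kernel to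
    x_n^n. *)
Lemma weightedE (R : realType) m (v : 'rV[R]_m.+1 -> R) f x :
  hinfty v f -> half_space x ->
  weighted v x = 2 / omega m.+1 * \int[lebesgue_tuple R m]_y (kernel x y * f y).
Proof.
move=> [_ fL vE] hx; rewrite /weighted vE// /poisson mulrCA; congr (_ * _).
have [ig _] := integrable_mul_Lfun fL
  (integrableZl measurableT (normal_coord x) (integrable_dist hx)).
rewrite -RintegralZl//.
by apply: eq_Rintegral => y _; rewrite kernelE [normal_coord x ^+ m.+1]exprSr !mulrA.
Qed.

Lemma derive_weighted (R : realType) m (v : 'rV[R]_m.+1 -> R) f x z :
  hinfty v f -> half_space x ->
  'D_z (weighted v) x = 2 / omega m.+1 * \int[lebesgue_tuple R m]_y (dkernel z x y * f y).
Proof.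
move=> hv hx; have [_ fL _] := hv; have x0 : 0 < normal_coord x by [].
apply/cvg_lim => //.
pose q (h : R) : R := h^-1 *: (\int[lebesgue_tuple R m]_y (kernel (x + h *: z) y * f y) -
           \int[lebesgue_tuple R m]_y (kernel x y * f y)).
have cq : (fun h => 2 / omega m.+1 * q h) @ (0 : R)^' -->
    2 / omega m.+1 * \int[lebesgue_tuple R m]_y (dkernel z x y * f y).
  by apply: cvgM; [exact: cvg_cst|exact: cvg_integral_kernel].
suff wq : \forall h \near (0 : R)^', 2 / omega m.+1 * q h =
    h^-1 *: ((weighted v \o shift x) (h *: z) - weighted v x).
  exact: cvg_trans (near_eq_cvg wq) cq.
have d0 : 0 < normal_coord x / 2 / (enorm z + 1).
  by rewrite !divr_gt0 // ltr_wpDl ?enorm_ge0.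
near=> h.
have hh : `|h| * enorm z <= normal_coord x / 2.
  have : `|h| < normal_coord x / 2 / (enorm z + 1) by near: h; exact: dnbhs0_lt.
  rewrite ltr_pdivlMr ?ltr_wpDl ?enorm_ge0// => /ltW; apply: le_trans.
  by rewrite ler_wpM2l// lerDl.
have [hxh _ _] := half_space_line [tuple of nseq m 0] hx hh.
rewrite /= [h *: z + x]addrC !(weightedE hv)//.
by rewrite -mulrBr; exact: mulrCA.
Unshelve. all: end_near. Qed.

(** * The sharp bound *)

Lemma is_derive_normal_coord (R : realType) m (x z : 'rV[R]_m.+1) :
  is_derive x z (@normal_coord R m) (normal_coord z).
Proof.
have d : differentiable (@normal_coord R m) x by exact: differentiable_coord.
apply: DeriveDef; first exact: diff_derivable.
apply/cvg_lim => //; apply: cvg_near_cst; near=> h.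
rewrite /= /normal_coord !mxE addrK; apply: mulKf.
by near: h; exact: nbhs_dnbhs_neq.
Unshelve. all: end_near. Qed.

Lemma weighted_cst1 (R : realType) m :
  weighted (cst 1) = @normal_coord R m ^+ m.
Proof. by apply/funext => x; rewrite /weighted mulr1 exprfctE. Qed.

Lemma derive_weighted_cst1 (R : realType) m (x z : 'rV[R]_m.+1) :
  'D_z (weighted (cst 1)) x = m%:R * normal_coord x ^+ m.-1 * normal_coord z.
Proof.
rewrite weighted_cst1.
by have [_ ->] := is_deriveX m (is_derive_normal_coord x z).
Qed.

(** Integrating [slope_bound] requires no other integrals than those supplied
    by the constant function: the mass of the Poisson kernel and the derivative of
    x_n^m. *)
Lemma integral_norm_dkernel (R : realType) m (x z : 'rV[R]_m.+1) :
  (2 <= m)%N -> half_space x -> 0 < enorm z ->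
  2 / omega m.+1 * \int[lebesgue_tuple R m]_y `|dkernel z x y| <=
    m%:R * normal_coord x ^+ m.-1 * enorm z.
Proof.
move=> m2 hx z0; have x0 : 0 < normal_coord x by [].
have [w0 I1] := integral_poisson_kernel hx.
have c0 : 0 < 2 / omega m.+1 :> R by rewrite divr_gt0.
set c := 2 / omega m.+1 in c0 *; set N := normal_coord x in x0 I1 *.
set L := enorm z in z0 *; set zn := normal_coord z.
have cI1 : c * \int[lebesgue_tuple R m]_y enorm (bembed y - x) ^- m.+1 = N^-1.
  by rewrite /Rintegral I1 /c/=; field; rewrite !gt_eqF.
have cI2 : c * \int[lebesgue_tuple R m]_y dkernel z x y = m%:R * N ^+ m.-1 * zn.
  rewrite -derive_weighted_cst1 (derive_weighted z (hinfty_cst1 R m) hx).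
  by congr (_ * _); apply: eq_Rintegral => y _; rewrite mulr1.
have iK := integrable_dkernel z hx.
have iP := integrable_dist hx.
(* slope_bound multiplied by the positive factor of dkernelE, then integrated. *)
pose e := (L ^+ 2 - zn ^+ 2) / 2 * (m.+1%:R * N ^+ m).
have H : \int[lebesgue_tuple R m]_y (`|dkernel z x y| * L) <=
    \int[lebesgue_tuple R m]_y (zn * dkernel z x y + e * enorm (bembed y - x) ^- m.+1).
  apply: le_Rintegral => //.
  - by apply: eq_integrable (integrableZr measurableT L (integrable_norm iK)).
  - apply: eq_integrable (integrableD measurableT (integrableZl measurableT zn iK)
      (integrableZl measurableT e iP)) => //.
  move=> y _; rewrite dkernelE//.
  set r := enorm (bembed y - x).
  have r0 : 0 < r by exact: enorm_bembed_gt0.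
  pose k := m.+1%:R * N ^+ m * r ^- m.+1 / r ^+ 2.
  have k0 : 0 <= k by rewrite !mulr_ge0 ?invr_ge0 ?exprn_ge0 ?(ltW r0) ?(ltW x0).
  have -> : m.+1%:R * N ^+ m * (r ^- m.+1 * (slope x z y / r ^+ 2)) = k * slope x z y.
    by rewrite /k; ring.
  have -> : e * r ^- m.+1 = k * ((L ^+ 2 - zn ^+ 2) / 2 * r ^+ 2).
    by rewrite /e /k; field; rewrite expf_neq0 ?gt_eqF.
  rewrite normrM (ger0_norm k0) [zn * _]mulrCA -mulrDr -[leLHS]mulrA ler_wpM2l//.
  exact: slope_bound.
rewrite RintegralZr// ?integrable_norm// in H.
rewrite RintegralD ?RintegralZl// in H; last 2 first.
- exact: (integrableZl measurableT zn iK).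
- exact: (integrableZl measurableT e iP).
have {}H := ler_wpM2l (ltW c0) H.
rewrite mulrDr [c * (zn * _)]mulrCA cI2 [c * (e * _)]mulrCA cI1 in H.
rewrite -(ler_pM2r z0) -[leLHS]mulrA; apply: le_trans H _.
have -> : e / N = (L ^+ 2 - zn ^+ 2) * (m.+1%:R / 2 * N ^+ m.-1).
  have Nm : N ^+ m = N * N ^+ m.-1 by rewrite -exprS prednK// ltnW.
  by rewrite /e Nm; field; rewrite gt_eqF.
have S : 0 <= L ^+ 2 - zn ^+ 2.
  rewrite subr_ge0 /L sqr_enorm big_ord_recr/= lerDr sumr_ge0// => i _; exact: sqr_ge0.
(* Here n / 2 <= n - 1 decides in favour of the normal direction. *)
have mm : m.+1%:R / 2 <= m%:R :> R.
  by rewrite ler_pdivrMr// -natrM ler_nat muln2 -addnn -addn1 leq_add2l (leq_trans _ m2).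
have P : 0 <= N ^+ m.-1 by rewrite exprn_ge0 ?ltW.
have := ler_wpM2l S (ler_wpM2r P mm).
lra.
Qed.

Lemma derive_weighted_le (R : realType) m (v : 'rV[R]_m.+1 -> R) f x z :
  (2 <= m)%N -> hinfty v f -> half_space x -> 0 < enorm z ->
  `|'D_z (weighted v) x| <= m%:R * normal_coord x ^+ m.-1 * enorm z * supnorm f.
Proof.
move=> m2 hv hx z0; have [_ fL _] := hv.
have [w0 _] := integral_poisson_kernel hx.
have c0 : 0 < 2 / omega m.+1 :> R by rewrite divr_gt0.
rewrite (derive_weighted z hv hx) normrM (gtr0_norm c0).
have [_ le] := integrable_mul_Lfun fL (integrable_dkernel z hx).
apply: le_trans (ler_wpM2l (ltW c0) le) _.
by rewrite mulrA ler_wpM2r ?supnorm_ge0// integral_norm_dkernel.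
Qed.

Lemma differentiable_weighted (R : realType) m (v : 'rV[R]_m.+1 -> R) f x :
  (2 <= m)%N -> hinfty v f -> half_space x -> differentiable (weighted v) x.
Proof.
case: m v f x => // m v f x _ [[hC _] _ _] hx.
have [dv _ _] := hC _ hx.
have -> : weighted v = (@normal_coord R m.+1 ^+ m.+1) * v.
  by apply/funext => y; rewrite /weighted !fctE.
apply: differentiableM => //; apply: differentiableX.
exact: differentiable_coord.
Qed.

Lemma derive_grad (R : realType) n (w : 'rV[R]_n.+1 -> R) x z :
  differentiable w x -> 'D_z w x = \sum_i z ord0 i * grad w x ord0 i.
Proof.
move=> dw; rewrite deriveE// {1}(row_sum_delta z) linear_sum/=.
by apply: eq_bigr => i _; rewrite linearZ/= mxE /partial deriveE.
Qed.

(** The derivative in the direction of the gradient is the square of its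
    length. *)
Lemma enorm_grad_le (R : realType) m (v : 'rV[R]_m.+1 -> R) f x :
  (2 <= m)%N -> hinfty v f -> half_space x ->
  enorm (grad (weighted v) x) <= m%:R * normal_coord x ^+ m.-1 * supnorm f.
Proof.
move=> m2 hv hx; set g := grad _ _.
have x0 : 0 < normal_coord x by [].
have [g0|g0] := ltP 0 (enorm g); last first.
  by rewrite (le_trans g0)// !mulr_ge0 ?supnorm_ge0// exprn_ge0 ?ltW.
have := derive_weighted_le m2 hv hx g0.
rewrite (derive_grad _ (differentiable_weighted m2 hv hx)) -/g.
under eq_bigr do rewrite -expr2.
by rewrite -sqr_enorm ger0_norm ?sqr_ge0// expr2 [leRHS]mulrAC ler_pM2r.
Qed.

Lemma grad_weighted_cst1 (R : realType) m (x : 'rV[R]_m.+1) i :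
  grad (weighted (cst 1)) x ord0 i =
    m%:R * normal_coord x ^+ m.-1 * (i == ord_max)%:R.
Proof.
by rewrite mxE /partial derive_weighted_cst1 /normal_coord !mxE/= eq_sym.
Qed.

Lemma enorm_grad_weighted_cst1 (R : realType) m (x : 'rV[R]_m.+1) : half_space x ->
  enorm (grad (weighted (cst 1)) x) = m%:R * normal_coord x ^+ m.-1.
Proof.
move=> hx; have x0 : 0 < normal_coord x by [].
rewrite /enorm (bigD1 ord_max)//= big1 ?addr0; last first.
  by move=> i /negbTE im; rewrite grad_weighted_cst1 im mulr0 expr0n.
rewrite grad_weighted_cst1 eqxx mulr1 sqrtr_sqr ger0_norm//.
by rewrite mulr_ge0 ?exprn_ge0 ?(ltW x0).
Qed.

Lemma partial_le_enorm_grad (R : realType) n (w : 'rV[R]_n.+1 -> R) x i :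
  `|partial i w x| <= enorm (grad w x).
Proof.
rewrite -[leRHS]ger0_norm ?enorm_ge0// -ler_sqr ?nnegrE// !real_normK ?num_real//.
rewrite sqr_enorm (bigD1 i)//= mxE lerDl sumr_ge0// => j _; exact: sqr_ge0.
Qed.

Theorem corollary5 (R : realType) (m : nat) (hn : (3 <= m.+1)%N)
    (x : 'rV[R]_m.+1) (hx : half_space x) :
  sharp_grad_coef x ((m.+1 - 1)%:R * normal_coord x ^+ (m.+1 - 2)) /\
  sup_unit_ball (fun v => `|partial ord_max (weighted v) x|) =
  sup_unit_ball (fun v => enorm (grad (weighted v) x)).
Proof.
have x0 : 0 < normal_coord x by [].
have m2 : (2 <= m)%N by [].
rewrite subn1 subSS subn1 /=.
set C := m%:R * _.
have C0 : 0 <= C by rewrite mulr_ge0 ?exprn_ge0 ?(ltW x0).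
have h1 := hinfty_cst1 R m.
split.
  split => [v f hv|D]; first exact: enorm_grad_le.
  by move=> /(_ _ _ h1); rewrite enorm_grad_weighted_cst1// supnorm_cst1 mulr1.
have top (F : ('rV[R]_m.+1 -> R) -> R) :
    (forall v f, hinfty v f -> F v <= enorm (grad (weighted v) x)) ->
    F (cst 1) = C -> sup_unit_ball F = C%:E.
  move=> Fle F1; apply/eqP; rewrite eq_le; apply/andP; split.
    apply: ge_ereal_sup => _ [v [f [hv f1 ->]]]; rewrite lee_fin.
    apply: le_trans (Fle _ _ hv) _; apply: le_trans (enorm_grad_le m2 hv hx) _.
    by rewrite ler_piMr.
  apply: ereal_sup_ubound; exists (cst 1), (cst 1).
  by split; rewrite ?supnorm_cst1 ?F1.
rewrite (top (fun v => enorm _)) //; last exact: enorm_grad_weighted_cst1.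
rewrite top // => [v f hv|]; first exact: partial_le_enorm_grad.
have := @grad_weighted_cst1 R m x ord_max; rewrite mxE eqxx mulr1 => ->.
by rewrite ger0_norm.
Qed.
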